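(* Let $h\geq 3$ and $t\geq 1$ be integers, and let $(T,\mathcal{S})$ with $\mathcal{S}=(S_u)_{u\in V(G)}$ be an orthodox $(h,2,t)$-representation of a graph $G$ such that, for every leaf $x$ of $T$, there is some vertex $u$ of $G$ with $x\in V(S_u)$. Then $G$ is (isomorphic to) the line graph $L(H)$ of a multigraph $H$ without loops, and, if $G$ is twin-free, then $H$ is a (simple) graph. Furthermore, if $G$ is a connected twin-free graph of order at least $4$, and $H$ has no isolated vertices, then: (1) $H$ is unique up to isomorphism; (2) there is a bijection $\phi:V(H)\to \mathcal{L}(T)$; and (3) two distinct vertices $x$ and $y$ of $H$ are adjacent in $H$ if and only if the path in $T$ between $\phi(x)$ and $\phi(y)$ is one of the subtrees $S_u$, $u\in V(G)$.
   Context: All graphs are finite, undirected and simple; multigraphs may have parallel edges and loops. For a tree $T$, $\mathcal{L}(T)$ denotes the set of leaves of $T$, i.e. vertices of degree at most $1$. The line graph $L(H)$ of a multigraph $H$ has vertex set $E(H)$, two distinct vertices being adjacent iff the corresponding edges of $H$ share an endpoint. Two distinct vertices $u,v$ of a graph are twins if $N[u]=N[v]$ (closed neighborhoods); a graph is twin-free if it has no twins. For positive integers $h,s,t$, an orthodox $(h,s,t)$-representation of a graph $G$ is a pair $(T,\mathcal{S})$, where $T$ is a tree of maximum degree at most $h$ and $\mathcal{S}=(S_u)_{u\in V(G)}$ is a collection of subtrees of $T$ of maximum degree at most $s$, one for each vertex of $G$, such that every leaf of each $S_u$ is a leaf of $T$, and, for every two distinct vertices $u,v$ of $G$, the following are equivalent: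 (i) $u$ and $v$ are adjacent; (ii) $S_u$ and $S_v$ have at least $t$ vertices in common; (iii) $S_u$ and $S_v$ share a leaf of $T$.
   Formalization: For t = 1, parts (2) and (3) are stated under the added assumption that every subtree S_u has at least two vertices; they fail whenever some S_u is a single leaf of T, since H then has more vertices than T has leaves. *)

(* Defs.v *)
From mathcomp Require Import all_boot.

Set Implicit Arguments.
Unset Strict Implicit.
Unset Printing Implicit Defensive.

Record sgraph := SGraph {
  svertex :> finType;
  adj : rel svertex;
  adj_sym : symmetric adj;
  adj_irrefl : irreflexive adj }.

Arguments adj {s} x y.

Section SimpleGraphs.
Variable G : sgraph.

Definition nbhd (x : G) : {set G} := [set y | adj x y].
Definition closed_nbhd (x : G) : {set G} := x |: nbhd x.
Definition degree (x : G) : nat := #|nbhd x|.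
Definition max_degree_le (k : nat) : Prop := forall x : G, degree x <= k.

Definition leaves : {set G} := [set x | degree x <= 1].

Definition connected_graph : Prop :=
  0 < #|[set: G]| /\ forall x y : G, connect adj x y.

Definition acyclic : Prop :=
  forall c : seq G, 2 < size c -> ~ ucycle adj c.

Definition is_tree : Prop := connected_graph /\ acyclic.

Definition twins (u v : G) : Prop := u <> v /\ closed_nbhd u = closed_nbhd v.
Definition twin_free : Prop := forall u v : G, ~ twins u v.

Definition path_between (x y : G) (A : {set G}) : Prop :=
  exists p : seq G,
    [/\ path adj x p, last x p = y, uniq (x :: p) & A = [set z in x :: p]].

Section Induced.
Variable A : {set G}.

Definition induced_adj : rel {x : G | x \in A} :=
  fun x y => adj (val x) (val y).

Lemma induced_adj_sym : symmetric induced_adj.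
Proof. by move=> x y; apply: adj_sym. Qed.

Lemma induced_adj_irrefl : irreflexive induced_adj.
Proof. by move=> x; apply: adj_irrefl. Qed.

Definition induced : sgraph := SGraph induced_adj_sym induced_adj_irrefl.
End Induced.

End SimpleGraphs.

Definition sgraph_iso (G G' : sgraph) : Prop :=
  exists2 f : G -> G', bijective f & forall x y : G, adj (f x) (f y) = adj x y.

(* The set of ends of an edge has one element exactly when the edge is a loop;
   distinct edges with the same set of ends are parallel. *)
Record mgraph := MGraph {
  mvertex : finType;
  medge : finType;
  ends : medge -> {set mvertex};
  ends_card : forall e, 1 <= #|ends e| <= 2 }.

Arguments ends {m} e.

Section Multigraphs.
Variable H : mgraph.

Definition is_loop (e : medge H) : Prop := #|ends e| = 1.
Definition loopless : Prop := forall e : medge H, ~ is_loop e.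
Definition parallel (e f : medge H) : Prop := e <> f /\ ends e = ends f.
Definition simple_mgraph : Prop :=
  loopless /\ forall e f : medge H, ~ parallel e f.

Definition isolated (x : mvertex H) : Prop :=
  forall e : medge H, x \notin ends e.
Definition no_isolated : Prop := forall x : mvertex H, ~ isolated x.

Definition madj (x y : mvertex H) : Prop :=
  exists e : medge H, ends e = [set x; y].

Definition line_adj : rel (medge H) :=
  fun e f => (e != f) && [exists x, (x \in ends e) && (x \in ends f)].

Lemma line_adj_sym : symmetric line_adj.
Proof.
move=> e f; rewrite /line_adj eq_sym; congr (_ && _).
by apply: eq_existsb => x; rewrite andbC.
Qed.

Lemma line_adj_irrefl : irreflexive line_adj.
Proof. by move=> e; rewrite /line_adj eqxx. Qed.

Definition line_graph : sgraph := SGraph line_adj_sym line_adj_irrefl.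

End Multigraphs.

Definition mgraph_iso (H H' : mgraph) : Prop :=
  exists (f : mvertex H -> mvertex H') (g : medge H -> medge H'),
    [/\ bijective f, bijective g & forall e, ends (g e) = f @: ends e].

(* A subtree of the tree T is given by its vertex set: every connected
   subgraph of a tree is induced. *)
Definition orthodox_rep (h s t : nat) (G T : sgraph) (S : G -> {set T}) : Prop :=
  [/\ is_tree T /\ max_degree_le T h,
      forall u : G, is_tree (induced (S u)) /\ max_degree_le (induced (S u)) s,
      forall (u : G) (x : induced (S u)),
        x \in leaves (induced (S u)) -> val x \in leaves T
    & forall u v : G, u <> v ->
        (adj u v <-> t <= #|S u :&: S v|) /\
        (adj u v <-> exists x : T, [/\ x \in leaves T, x \in S u & x \in S v])].

(* For t = 1 a subtree S u may consist of a single leaf x of T.  It then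
   corresponds to an edge of H joining x to an additional vertex of degree 1,
   which is not a leaf of T, so that H has more vertices than T has leaves.
   Example: T has edges aq, qp, pb, pr, rc, rd, and the subtrees are {a} and the
   paths between a and b, b and c, c and d; then G is the path on 4 vertices,
   H is the path on 5 vertices, and T has the 4 leaves a, b, c, d.
   For t >= 2 this cannot happen when G is connected with at least 2 vertices,
   because the vertex u would be isolated in G. *)
Definition no_trivial_subtree (G T : sgraph) (S : G -> {set T}) : Prop :=
  forall u : G, 2 <= #|S u|.

(* Main.v *)
(** Each subtree [S u] is a path whose ends are exactly the leaves of [T] that it
    contains, so [G] is the line graph of the multigraph on the leaves of [T]
    whose edges are these pairs of ends (with an additional vertex for each
    single-leaf subtree).  Parallel edges are twins.  The rest is Whitney's
    theorem.  Let two simple graphs have the same connected line graph.  If every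
    triple of pairwise adjacent edges is a claw in both or a triangle in both,
    then stars correspond to stars, hence vertices to vertices.  Otherwise some
    triple is a claw in one and a triangle in the other; every other edge meets
    an even number of edges of the triangle, which forces both graphs into a
    [K4], where, given a fourth edge, an isomorphism is explicit. *)

Require Import Defs.
From mathcomp Require Import all_boot perm.

Set Implicit Arguments.
Unset Strict Implicit.
Unset Printing Implicit Defensive.

(** * Paths, and trees of maximum degree at most 2 *)

Section Paths.
Variable P : sgraph.
Implicit Types (x y z : P) (p : seq P).

Lemma inner_vertex_neighbors x p z :
  path adj x p -> uniq (x :: p) -> z \in x :: p -> z != x -> z != last x p ->
  exists a b, [/\ a != b, adj z a, adj z b, a \in x :: p & b \in x :: p].
Proof.
move=> pth uq; rewrite inE => /orP[/eqP->|zp]; first by rewrite eqxx.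
case/splitPr: zp pth uq => p1 [|b p2] pth uq _ zl.
  by rewrite last_cat eqxx in zl.
exists (last x p1), b; move: pth.
rewrite cat_path /= => /and4P[_ az zb _].
have lmem : last x p1 \in x :: p1 by apply: mem_last.
split=> //; last 2 first.
- by rewrite -cat_cons mem_cat lmem.
- by rewrite -cat_cons mem_cat !inE eqxx !orbT.
- move: uq; rewrite -cat_cons cat_uniq => /and3P[_ /hasPn nin _].
  apply/eqP=> eb; have : last x p1 \notin x :: p1.
    by apply: nin; rewrite eb !inE eqxx orbT.
  by rewrite lmem.
- by rewrite adj_sym.
Qed.

Lemma degree_gt1 z a b : a != b -> adj z a -> adj z b -> 1 < degree z.
Proof.
move=> ab za zb; rewrite /degree (cardD1 a) (cardD1 b) !inE za zb eq_sym ab.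
by [].
Qed.

Lemma degree2_nbhd z a b :
  degree z <= 2 -> a != b -> adj z a -> adj z b -> nbhd z = [set a; b].
Proof.
move=> dz ab za zb; apply/esym/eqP.
rewrite eqEcard cards2 ab [_ <= _]dz andbT.
by apply/subsetP=> y; rewrite !inE => /orP[]/eqP->.
Qed.

Lemma path_between_sym x y (A : {set P}) :
  path_between x y A -> path_between y x A.
Proof.
case=> p [pth <- uq ->]; exists (rev (belast x p)).
have e : last x p :: rev (belast x p) = rev (x :: p).
  by rewrite (lastI x p) rev_rcons.
split.
- rewrite rev_path; have -> // : path (fun z => adj^~ z) x p = path adj x p.
  by apply: eq_path => u v; rewrite adj_sym.
- by case: (p) => //= a q; rewrite rev_cons last_rcons.
- by rewrite e rev_uniq.
- by rewrite e; apply/setP=> z; rewrite !inE mem_rev !inE.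
Qed.

(** A neighbour of [x] lying beyond the second vertex of the path would close a cycle with the
    initial segment leading to it, so only the second vertex can be adjacent to [x]. *)
Lemma acyclic_end_degree x p : acyclic P ->
  path adj x p -> uniq (x :: p) -> (forall z, adj x z -> z \in p) ->
  degree x <= 1.
Proof.
move=> acy pth uq mx; rewrite /degree.
(* The default [x] of [head] occurs only for empty [p], where [mx] already rules out every
   neighbour. *)
have sub : nbhd x \subset [set head x p].
  apply/subsetP=> z; rewrite !inE => xz; have := mx _ xz.
  case: p pth uq {mx} => //= y p /andP[xy pth] uq.
  rewrite inE => /orP[//|/splitPr zp]; case: zp pth uq => p1 p2 pth uq.
  case: (acy (x :: y :: rcons p1 z)); first by rewrite /= size_rcons.
  have {}uq : uniq (x :: y :: p1 ++ z :: p2) by exact: uq.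
  move: pth uq; rewrite -cat_rcons cat_path => /andP[pth _].
  rewrite -!cat_cons cat_uniq => /andP[uq _].
  rewrite /ucycle uq andbT /= xy /= rcons_path pth last_rcons /=.
  by rewrite adj_sym.
by apply: leq_trans (subset_leq_card sub) _; rewrite cards1.
Qed.

(** In a path with as many vertices as possible, a neighbour of an end outside the path would extend
    it. *)
Lemma longest_path : 0 < #|P| ->
  exists x p, [/\ path adj x p, uniq (x :: p),
    forall z, adj x z -> z \in p & forall z, adj (last x p) z -> z \in x :: p].
Proof.
case/card_gt0P=> x0 _.
pose Q n := [exists s : n.-tuple P, sorted adj s && uniq s].
have exQ : exists n, Q n.
  by exists 1; apply/existsP; exists [tuple x0].
have bQ n : Q n -> n <= #|P|.
  case/existsP=> s /andP[_ /card_uniqP]; rewrite size_tuple => <-.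
  exact: max_card.
case: (ex_maxnP exQ bQ) => n /existsP[s /andP[ss us]] mx.
have mxs (q : seq P) : sorted adj q -> uniq q -> size q <= n.
  move=> sq uq; apply: mx; apply/existsP; exists (in_tuple q).
  by rewrite /= sq uq.
have n0 : 0 < n by apply: (mxs [:: x0]).
case: s ss us => s /= /eqP sz; case: s sz => [sz|x p sz /= ss us].
  by rewrite -sz in n0.
exists x, p; split=> // z adjz.
- case: (boolP (z \in x :: p)) => [|nz].
    by rewrite inE => /orP[/eqP e|//]; rewrite e adj_irrefl in adjz.
  have /negP[] : ~~ (size (z :: x :: p) <= n) by rewrite -sz /= ltnn.
  by apply: mxs; rewrite ?cons_uniq ?nz //= adj_sym adjz.
- apply/negPn/negP => nz.
  have /negP[] : ~~ (size (rcons (x :: p) z) <= n).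
    by rewrite size_rcons -sz ltnn.
  by apply: mxs; rewrite ?rcons_uniq ?nz //= rcons_path ss.
Qed.

(** On a longest path, an inner vertex has its two allowed neighbours on the path and an end has no
    neighbour outside. The path is thus closed under adjacency, and connectedness makes it the whole
    tree. *)
Lemma tree_max_degree2_is_path : is_tree P -> max_degree_le P 2 ->
  exists x p, [/\ path adj x p, uniq (x :: p), forall z, z \in x :: p
    & leaves P = [set x; last x p]].
Proof.
case=> [[ne conn] acy] md; rewrite cardsT in ne.
have [x [p [pth uq mx ml]]] := longest_path ne.
have dx : degree x <= 1 by apply: acyclic_end_degree pth uq mx.
have dl : degree (last x p) <= 1.
  have [q [pq lq uqq eq]] : path_between (last x p) x [set z in x :: p].
    by apply: path_between_sym; exists p.
  apply: acyclic_end_degree pq uqq _ => // z lz.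
  have : z \in [set z in x :: p] by rewrite inE ml.
  rewrite eq !inE => /orP[/eqP e|//].
  by rewrite e adj_irrefl in lz.
have inner z : z \in x :: p -> z != x -> z != last x p ->
    1 < degree z /\ forall y, adj z y -> y \in x :: p.
  move=> zp zx zl.
  have [a [b [ab za zb ap bp]]] := inner_vertex_neighbors pth uq zp zx zl.
  split; first exact: degree_gt1 za zb.
  move=> y zy; have : y \in nbhd z by rewrite inE.
  by rewrite (degree2_nbhd (md z) ab za zb) !inE => /orP[]/eqP->.
have all_in z : z \in x :: p.
  have cl : closed adj (mem (x :: p)).
    apply: intro_closed; first by apply: sym_connect_sym; apply: adj_sym.
    move=> u v uv /= up.
    have [eu|ux] := eqVneq u x; first by rewrite inE mx ?orbT // -eu.
    have [eu|ul] := eqVneq u (last x p); first by rewrite ml // -eu.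
    by have [_] := inner _ up ux ul; apply.
  by rewrite -[_ \in _](closed_connect cl (conn x z)) inE eqxx.
exists x, p; split=> //.
apply/setP=> z; rewrite !inE.
have [->|zx] := eqVneq z x; first by rewrite dx.
have [->|zl] := eqVneq z (last x p); first by rewrite dl.
by have [] := inner z (all_in z) zx zl; case: leqP.
Qed.

End Paths.

(** * Leaves of [T] on a subtree of maximum degree at most 2 *)

Section LeavesOfSubtrees.
Variables (T : sgraph) (A : {set T}).
Hypothesis treeA : is_tree (induced A).
Hypothesis degA : max_degree_le (induced A) 2.
Hypothesis leafA : forall x : induced A,
  x \in leaves (induced A) -> val x \in leaves T.

Lemma induced_degree (x : induced A) : degree x <= degree (val x).
Proof.
rewrite /degree -(card_imset (mem (nbhd x)) val_inj).
apply/subset_leq_card/subsetP=> _ /imsetP[y + ->].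
by rewrite !inE.
Qed.

(** Degrees only drop in an induced subgraph, so a leaf of [T] in [A] is a leaf of [A], that is, an
    end of the path; [leafA] gives the converse. The ends coincide when [A] is a single vertex. *)
Lemma subtree_is_path : exists x y,
  path_between x y A /\ A :&: leaves T = [set x; y].
Proof.
have [x [p [pth uq all_in lv]]] := tree_max_degree2_is_path treeA degA.
exists (val x), (val (last x p)); split.
  exists (map val p); split.
  - by rewrite path_map.
  - by rewrite last_map.
  - by rewrite -map_cons map_inj_uniq //; apply: val_inj.
  - apply/setP=> z; rewrite inE -map_cons; apply/idP/mapP => [zA|[y _ ->]].
      by exists (Sub z zA); rewrite ?all_in.
    exact: valP.
apply/setP=> z; rewrite !inE; apply/andP/orP.
  case=> zA zl; have : (Sub z zA : induced A) \in leaves (induced A).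
    rewrite inE; have := induced_degree (Sub z zA : induced A).
    by move=> /leq_trans; apply.
  by rewrite lv !inE => /orP[]/eqP e; [left|right]; rewrite -e.
have xl : x \in leaves (induced A) by rewrite lv !inE eqxx.
have ll : last x p \in leaves (induced A) by rewrite lv !inE eqxx orbT.
case=> /eqP->; (split; first exact: valP).
  by have := leafA xl; rewrite inE.
by have := leafA ll; rewrite inE.
Qed.

Lemma card_subtree_leaves : 1 <= #|A :&: leaves T| <= 2.
Proof. by have [x [y [_ ->]]] := subtree_is_path; rewrite cards2; case: eqP. Qed.

Lemma card_nontrivial_subtree_leaves : 2 <= #|A| -> #|A :&: leaves T| = 2.
Proof.
have [x [y [[p [pth lp uq eA]] ->]]] := subtree_is_path; rewrite cards2.
have [exy|//] := eqVneq x y; case: p pth lp uq eA => [|a p] _ /= lp uq ->.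
  by rewrite cardsE (card_uniqP _).
by move: uq; rewrite exy -{1}lp mem_last.
Qed.

(** Inner vertices of a path have degree at least 2, so they are not leaves of [T]. Conversely, [A]
    is a path between some two ends, and these must be [x] and [y] in some order. *)
Lemma path_between_leavesP x y : x \in leaves T -> y \in leaves T -> x != y ->
  path_between x y A <-> A :&: leaves T = [set x; y].
Proof.
move=> xl yl xy; split.
  case=> p [pth lp uq eA]; apply/setP=> z; rewrite in_setI in_set2.
  have [->|zx] := eqVneq z x; first by rewrite xl eA !inE eqxx.
  have [->|zy] := eqVneq z y; first by rewrite yl eA inE -lp mem_last.
  apply/negP=> /andP[]; rewrite eA inE -lp in zy * => zp.
  have [a [b [ab za zb _ _]]] := inner_vertex_neighbors pth uq zp zx zy.
  by rewrite inE leqNgt (degree_gt1 ab za zb).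
move=> eA; have [x' [y' [pb]]] := subtree_is_path.
rewrite eA => /setP e; have := e x; have := e y; have := e x'; have := e y'.
rewrite !inE !eqxx /= !orbT => e1 e2 e3 e4.
have [ex|nx] := eqVneq x x'.
  move: e1 e3; rewrite -ex (eq_sym y x) (negPf xy) /= => + /esym/eqP-> //.
  by move=> _; rewrite ex.
move: e4 e2; rewrite (negPf nx) /= => /esym/eqP ex.
rewrite (eq_sym x' x) (negPf nx) /= => /eqP ey; rewrite ex -ey.
exact: path_between_sym.
Qed.

End LeavesOfSubtrees.

(** * Whitney's theorem on line graphs *)

(* [d] presents [G] as the line graph of a simple graph on [V] without isolated
   vertices: the vertices of [G] are the edges and [d u] is the pair of ends. *)
Record line_model (G : sgraph) (V : finType) (d : G -> {set V}) : Prop := {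
  model_card : forall u, #|d u| = 2;
  model_inj : injective d;
  model_cover : forall x, exists u, x \in d u;
  model_adj : forall u v, u != v ->
    adj u v <-> exists2 x, x \in d u & x \in d v }.

(** The permutation [s] of the edges is needed because a claw for [d] may be a triangle for [d'];
    then no bijection of the vertices induces the identity on the edges. *)
Definition model_iso (G : sgraph) (V V' : finType)
    (d : G -> {set V}) (d' : G -> {set V'}) : Prop :=
  exists (f : V -> V') (s : G -> G),
    [/\ bijective f, bijective s & forall u, d' (s u) = f @: d u].

(** For three pairwise adjacent edges of a line model, the only alternative is a triangle. *)
Definition claw (G V : finType) (d : G -> {set V}) u v w : bool :=
  [exists x, [&& x \in d u, x \in d v & x \in d w]].

Section Model.
Variables (G : sgraph) (V : finType) (d : G -> {set V}).
Hypothesis md : line_model d.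

Lemma model_pair u x y : x \in d u -> y \in d u -> x != y -> d u = [set x; y].
Proof.
move=> xu yu xy; apply/esym/eqP; rewrite eqEcard cards2 xy (model_card md).
by rewrite andbT; apply/subsetP=> z; rewrite !inE => /orP[]/eqP->.
Qed.

Lemma model_eq u v x y : x \in d u -> x \in d v -> y \in d u -> y \in d v ->
  x != y -> u = v.
Proof.
move=> xu xv yu yv xy; apply: (model_inj md).
by rewrite (model_pair xu yu xy) (model_pair xv yv xy).
Qed.

Lemma model_common u v x y : u != v ->
  x \in d u -> x \in d v -> y \in d u -> y \in d v -> x = y.
Proof.
move=> uv xu xv yu yv; apply/eqP/negPn/negP=> xy.
by rewrite (model_eq xu xv yu yv xy) eqxx in uv.
Qed.

Lemma model_other u x : x \in d u -> exists2 y, y \in d u & x != y.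
Proof.
move=> xu; have /eqP/cards2P[a [b [ab e]]] := model_card md u.
move: xu; rewrite e !inE => /orP[]/eqP->; [exists b|exists a];
  by rewrite // ?inE ?eqxx ?orbT // eq_sym.
Qed.

Lemma model_adjI u v x : u != v -> x \in d u -> x \in d v -> adj u v.
Proof. by move=> uv xu xv; apply/(model_adj md uv); exists x. Qed.

Lemma model_mem u x y z : x \in d u -> y \in d u -> x != y -> z \in d u ->
  z = x \/ z = y.
Proof.
move=> xu yu xy; rewrite (model_pair xu yu xy) !inE.
by case/orP=> /eqP; [left|right].
Qed.

End Model.

Lemma adj_neq (G : sgraph) (u v : G) : adj u v -> u != v.
Proof. by apply: contraTneq => ->; rewrite adj_irrefl. Qed.

Lemma model_iso_sym (G : sgraph) (V V' : finType)
    (d : G -> {set V}) (d' : G -> {set V'}) : model_iso d d' -> model_iso d' d.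
Proof.
case=> f [s [[f' ff' f'f] [s' ss' s's] e]].
exists f', s'; split; [by exists f | by exists s | move=> u].
rewrite -{2}(s's u) e -imset_comp -[LHS]imset_id.
by apply: eq_imset => x /=; rewrite ff'.
Qed.

Lemma connected_neighbor (G : sgraph) (u : G) :
  connected_graph G -> 1 < #|G| -> exists v, adj u v.
Proof.
case=> _ conn; rewrite (cardD1 u) inE ltnS => /card_gt0P[w].
rewrite !inE andbT => wu; have /connectP[[|v p] /=] := conn u w.
  by move=> _ e; rewrite e eqxx in wu.
by case/andP=> uv _ _; exists v.
Qed.

(** * Two models in which the same triples are claws *)

Section SameTriples.
Variables (G : sgraph) (V V' : finType).
Variables (d : G -> {set V}) (d' : G -> {set V'}).
Hypotheses (md : line_model d) (md' : line_model d').
Hypothesis same : forall u v w, adj u v -> adj u w -> adj v w ->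
  claw d u v w -> claw d' u v w.

(** An edge [w] through [x] forms a claw with [u] and [v] for [d], hence for [d']; its centre there
    is the only common end [x'] of [u] and [v]. *)
Lemma star_sub u v x x' w : u != v -> x \in d u -> x \in d v ->
  x' \in d' u -> x' \in d' v -> x \in d w -> x' \in d' w.
Proof.
move=> uv xu xv xu' xv' xw.
have [<-//|uw] := eqVneq u w; have [<-//|vw] := eqVneq v w.
have /existsP[y /and3P[yu yv yw]] : claw d' u v w.
  apply: same; [exact: model_adjI xu xv|exact: model_adjI xu xw| |].
    exact: model_adjI xv xw.
  by apply/existsP; exists x; rewrite xu xv xw.
by rewrite (model_common md' uv xu' xv' yu yv).
Qed.
End SameTriples.

(** A vertex on two edges corresponds to their common end in the other model, by [star_sub] in both
    directions. A vertex on a single edge needs a separate choice. *)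
Lemma star_eq (G : sgraph) (V V' : finType)
    (d : G -> {set V}) (d' : G -> {set V'}) :
  line_model d -> line_model d' ->
  (forall u v w, adj u v -> adj u w -> adj v w -> claw d u v w = claw d' u v w) ->
  connected_graph G -> 1 < #|G| ->
  forall x, exists x', forall u, (x \in d u) = (x' \in d' u).
Proof.
move=> md md' same conn cardG x.
have star2 u v y y' : u != v -> y \in d u -> y \in d v ->
    y' \in d' u -> y' \in d' v -> forall w, (y \in d w) = (y' \in d' w).
  move=> uv yu yv yu' yv' w; apply/idP/idP.
    by apply: (star_sub md md' _ uv) => // a b c ab ac bc; rewrite same.
  by apply: (star_sub md' md _ uv) => // a b c ab ac bc; rewrite same.
have [u xu] := model_cover md x.
have [v /andP[uv xv]|single] := pickP [pred v | (u != v) && (x \in d v)].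
  have /(model_adj md' uv)[x' xu' xv'] := model_adjI md uv xu xv.
  by exists x'; apply: star2 uv _ _ _ _.
have only w : x \in d w -> u = w.
  by move=> xw; have := single w; rewrite /= xw andbT => /negbFE/eqP.
have [v uv] := connected_neighbor u conn cardG; have nuv := adj_neq uv.
have [y yu yv] := (model_adj md nuv).1 uv.
have [y' yu' yv'] := (model_adj md' nuv).1 uv.
have star_y := star2 _ _ _ _ nuv yu yv yu' yv'.
have xy : x != y.
  by apply: contraNneq nuv => e; apply/eqP/only; rewrite e.
(* The end [y] of [u] corresponds to [y'], so [x] must go to the other end [x']. A second edge
   through [x'] would meet [u] at [y] for [d], hence contain [y'] as well, and so equal [u]. *)
have [x' xu' xy'] := model_other md' yu'.
exists x' => w; have [<-|uw] := eqVneq u w; first by rewrite xu xu'.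
apply/idP/idP=> [/only e|xw]; first by rewrite e eqxx in uw.
have /(model_adj md uw)[z zu zw] := model_adjI md' uw xu' xw.
case: (model_mem md xu yu xy zu) => ez; first by rewrite -ez.
have yw : y' \in d' w by rewrite -star_y -ez.
by rewrite (model_eq md' xu' xw yu' yw) ?eqxx // eq_sym in uw.
Qed.

(** Vertices with the same star are the two ends of an edge [u]; an edge adjacent to [u] would then
    contain both and equal [u]. A single edge shows why a neighbour is required. *)
Lemma star_inj (G : sgraph) (V : finType) (d : G -> {set V}) :
  line_model d -> connected_graph G -> 1 < #|G| ->
  forall x y, (forall u, (x \in d u) = (y \in d u)) -> x = y.
Proof.
move=> md conn cardG x y e; have [u xu] := model_cover md x.
have [v uv] := connected_neighbor u conn cardG; have nuv := adj_neq uv.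
have [z zu zv] := (model_adj md nuv).1 uv.
apply/eqP/negPn/negP=> xy; have yu := xu; rewrite e in yu.
have /orP[] : (x \in d v) || (y \in d v).
  by case: (model_mem md xu yu xy zu) => <-; rewrite zv ?orbT.
  by move=> xv; have yv := xv; rewrite e in yv;
    rewrite (model_eq md xu xv yu yv xy) eqxx in nuv.
by move=> yv; have xv := yv; rewrite -e in xv;
  rewrite (model_eq md xu xv yu yv xy) eqxx in nuv.
Qed.

(** Matching equal stars is a bijection of the vertices, by [star_eq] both ways and [star_inj], and
    it induces the identity on edges. *)
Lemma same_triples_iso (G : sgraph) (V V' : finType)
    (d : G -> {set V}) (d' : G -> {set V'}) :
  line_model d -> line_model d' ->
  (forall u v w, adj u v -> adj u w -> adj v w -> claw d u v w = claw d' u v w) ->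
  connected_graph G -> 1 < #|G| -> model_iso d d'.
Proof.
move=> md md' same conn cardG.
have ex := star_eq md md' same conn cardG.
have ex' x' : exists x, forall u, (x \in d u) = (x' \in d' u).
  have [|x e] := star_eq md' md _ conn cardG x'.
    by move=> u v w uv uw vw; rewrite same.
  by exists x => u; rewrite e.
have exb x : exists x', [forall u, (x \in d u) == (x' \in d' u)].
  by have [x' e] := ex x; exists x'; apply/forallP=> u; rewrite e.
pose f x := xchoose (exb x).
have fP x u : (x \in d u) = (f x \in d' u).
  by have /forallP/(_ u)/eqP := xchooseP (exb x).
have f_surj x' : exists x, f x = x'.
  have [x e] := ex' x'; exists x; apply: (star_inj md' conn cardG) => u.
  by rewrite -fP e.
have f_inj : injective f.
  by move=> x y e; apply: (star_inj md conn cardG) => u; rewrite !fP e.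
exists f, id; split; last 2 first.
- by exists id.
- move=> u; apply/setP=> x'; have [x <-] := f_surj x'.
  by rewrite (mem_imset _ _ f_inj) fP.
- apply: inj_card_bij => //; rewrite -(card_codom f_inj).
  apply/subset_leq_card/subsetP=> x' _; have [x <-] := f_surj x'.
  exact: codom_f.
Qed.

(** * A claw in one model that is a triangle in the other *)

Section MixedTriple.
Variables (G : sgraph) (V V' : finType).
Variables (d : G -> {set V}) (d' : G -> {set V'}).
Hypotheses (md : line_model d) (md' : line_model d').

(* [e], [f], [g] form a claw with centre [x] for [d] and a triangle for [d']. *)
Record mixed_triple (e f g : G) (x a b c : V) (p q r : V') : Prop := {
  mixed_e : [/\ x \in d e, a \in d e, r \in d' e & q \in d' e];
  mixed_f : [/\ x \in d f, b \in d f, r \in d' f & p \in d' f];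
  mixed_g : [/\ x \in d g, c \in d g, q \in d' g & p \in d' g];
  mixed_center : [/\ x != a, x != b & x != c];
  mixed_ends : [/\ a != b, a != c & b != c];
  mixed_triangle : [/\ r != q, r != p & q != p] }.

Lemma mixed_swap12 e f g x a b c p q r :
  mixed_triple e f g x a b c p q r -> mixed_triple f e g x b a c q p r.
Proof.
case=> -[? ? ? ?] [? ? ? ?] [? ? ? ?] [? ? ?] [? ? ?] [? ? ?].
by split; split=> //; rewrite eq_sym.
Qed.

Lemma mixed_swap23 e f g x a b c p q r :
  mixed_triple e f g x a b c p q r -> mixed_triple e g f x a c b p r q.
Proof.
case=> -[? ? ? ?] [? ? ? ?] [? ? ? ?] [? ? ?] [? ? ?] [? ? ?].
by split; split=> //; rewrite eq_sym.
Qed.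

Lemma mixed_neq e f g x a b c p q r : mixed_triple e f g x a b c p q r -> e != f.
Proof.
case=> -[xe ae _ _] [_ bf _ _] _ [xa xb _] [ab _ _] _.
apply/eqP=> E; rewrite -E in bf.
by case: (model_mem md xe ae xa bf) => e'; rewrite e' eqxx in xb ab.
Qed.

(* An edge meets an even number of edges of a triangle, and an edge meeting
   exactly two edges of a claw joins two of its ends. *)
Lemma mixed_edge e f g x a b c p q r w : mixed_triple e f g x a b c p q r ->
  w != e -> w != f -> w != g -> r \in d' w -> d w = [set a; b].
Proof.
case=> -[xe ae re qe] [xf bf rf pf] [xg cg qg pg] [xa xb xc] [ab ac bc].
move=> [rq rp qp] we wf wg rw.
(* If [w] contained [x], it would meet [g], so for [d'] it would contain [q] or [p] besides [r] and
   coincide with [e] or [f]. *)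
have xw : x \notin d w.
  apply/negP=> xw.
  have /(model_adj md' wg)[z zw zg] := model_adjI md wg xw xg.
  case: (model_mem md' qg pg qp zg) => ez; subst z.
    by rewrite (model_eq md' rw re zw qe rq) eqxx in we.
  by rewrite (model_eq md' rw rf zw pf rp) eqxx in wf.
have /(model_adj md we)[z zw ze] := model_adjI md' we rw re.
have /(model_adj md wf)[y yw yf] := model_adjI md' wf rw rf.
have aw : a \in d w.
  by case: (model_mem md xe ae xa ze) => ez; rewrite ez ?(negPf xw) in zw.
have bw : b \in d w.
  by case: (model_mem md xf bf xb yf) => ez; rewrite ez ?(negPf xw) in yw.
exact: model_pair.
Qed.

(** The edges of the triangle and those touching it for [d'] form a set closed under adjacency,
    hence everything. Indeed an edge touching it from outside has its ends for [d] among [a], [b],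
    [c], by [mixed_edge], so each neighbour of it equals or meets one of [e], [f], [g]. *)
Lemma mixed_total e f g x a b c p q r : connected_graph G ->
  mixed_triple e f g x a b c p q r -> forall w,
  [\/ w \in [:: e; f; g], r \in d' w, q \in d' w | p \in d' w].
Proof.
move=> [_ conn] mt w.
pose A := [set w | [|| w \in [:: e; f; g], r \in d' w, q \in d' w | p \in d' w]].
have AE v : (v \in A) =
  [|| v \in [:: e; f; g], r \in d' v, q \in d' v | p \in d' v] by rewrite inE.
suff : w \in A by rewrite AE => /or4P.
have meets v u : adj v u -> u \in [:: e; f; g] -> v \in A.
  have [[_ _ re qe] [_ _ rf pf] [_ _ qg pg] _ _ [rq rp qp]] := mt.
  move=> vu; have nvu := adj_neq vu.
  have [z zv zu] := (model_adj md' nvu).1 vu; rewrite AE !inE.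
  case/or3P=> /eqP eu; subst u.
  - by case: (model_mem md' re qe rq zu) => ez; rewrite -ez zv ?orbT.
  - by case: (model_mem md' rf pf rp zu) => ez; rewrite -ez zv ?orbT.
  - by case: (model_mem md' qg pg qp zu) => ez; rewrite -ez zv ?orbT.
have cl : closed adj (mem A).
  apply: intro_closed; first by apply: sym_connect_sym; apply: adj_sym.
  move=> u v uv uA.
  have [uin|nu] := boolP (u \in [:: e; f; g]).
    by apply: meets uin; rewrite adj_sym.
  have /and3P[ue uf ug] : [&& u != e, u != f & u != g].
    by rewrite !inE !negb_or in nu.
  have [vin|nv] := boolP (v \in [:: e; f; g]); first by rewrite AE vin.
  have /and3P[ve vf vg] : [&& v != e, v != f & v != g].
    by rewrite !inE !negb_or in nv.
  have sub : d u \subset [set a; b; c].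
    move: uA; rewrite AE !inE (negPf ue) (negPf uf) (negPf ug) /=.
    case/or3P=> uA.
    - rewrite (mixed_edge mt) //.
      by apply/subsetP=> z; rewrite !inE => ->.
    - rewrite (mixed_edge (mixed_swap23 mt)) //.
      by apply/subsetP=> z; rewrite !inE => /orP[]->; rewrite ?orbT.
    - rewrite (mixed_edge (mixed_swap23 (mixed_swap12 mt))) //.
      by apply/subsetP=> z; rewrite !inE => /orP[]->; rewrite ?orbT.
  have [z zu zv] := (model_adj md (adj_neq uv)).1 uv.
  have [[_ ae _ _] [_ bf _ _] [_ cg _ _] _ _ _] := mt.
  have /or3P[] : [|| z == a, z == b | z == c].
    by have := subsetP sub z zu; rewrite !inE orbA.
  - by move/eqP=> ez; subst z;
    apply: (meets v e); rewrite ?inE ?eqxx ?(model_adjI md ve zv ae).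
  - by move/eqP=> ez; subst z;
    apply: (meets v f); rewrite ?inE ?eqxx ?orbT ?(model_adjI md vf zv bf).
  - by move/eqP=> ez; subst z;
    apply: (meets v g); rewrite ?inE ?eqxx ?orbT ?(model_adjI md vg zv cg).
by rewrite -(closed_connect cl (conn e w)) AE !inE eqxx.
Qed.

(* Exchanging [g] with the edge [w0] joining [a] and [b] turns the edge
   bijection into one induced by [x -> r], [a -> q], [b -> p], [c -> o]. *)
Lemma mixed_iso e f g x a b c p q r w0 : connected_graph G ->
  mixed_triple e f g x a b c p q r ->
  w0 != e -> w0 != f -> w0 != g -> r \in d' w0 -> model_iso d d'.
Proof.
move=> conn mt w0e w0f w0g rw0.
have tot := mixed_total conn mt.
have dw0 := mixed_edge mt w0e w0f w0g rw0.
have eg := mixed_neq (mixed_swap23 mt).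
have fg := mixed_neq (mixed_swap23 (mixed_swap12 mt)).
have edge_q := mixed_edge (mixed_swap23 mt).
have edge_p := mixed_edge (mixed_swap23 (mixed_swap12 mt)).
have edge_r := mixed_edge mt.
have [[xe ae re qe] [xf bf rf pf] [xg cg qg pg] [xa xb xc] [ab ac bc]
  [rq rp qp]] := mt.
have [o ow0 ro] := model_other md' rw0.
have qo : q != o.
  apply: contraNneq w0e => E; subst o.
  by apply/eqP; apply: (model_eq md' rw0 re ow0 qe).
have po : p != o.
  apply: contraNneq w0f => E; subst o.
  by apply/eqP; apply: (model_eq md' rw0 rf ow0 pf).
(* A further edge through [r] would have the ends of [w0]. One through [q] or [p] shares [a] or [b]
   with [w0] for [d], so it meets [w0] for [d']; not at [r], since it would then be [e] or [f],
   hence at [o]. *)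
have kinds w : [\/ w \in [:: e; f; g; w0],
    d w = [set a; c] /\ d' w = [set q; o] |
    d w = [set b; c] /\ d' w = [set p; o]].
  have [win|] := boolP (w \in [:: e; f; g; w0]); first by constructor 1.
  rewrite !inE !negb_or => /and4P[we wf wg ww0].
  have ow z : z \in d w -> z \in [set a; b] -> r \notin d' w -> o \in d' w.
    rewrite -dw0 => zw zw0 nr.
    have /(model_adj md' ww0)[y yw yw0] := model_adjI md ww0 zw zw0.
    by case: (model_mem md' rw0 ow0 ro yw0) => ey; rewrite ey ?(negPf nr) in yw.
  case: (tot w) => [|rw|qw|pw].
  - by rewrite !inE (negPf we) (negPf wf) (negPf wg).
  - have dw := edge_r _ we wf wg rw.
    by rewrite -dw0 in dw; rewrite (model_inj md dw) eqxx in ww0.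
  - have dw := edge_q _ we wg wf qw; constructor 2; split=> //.
    apply: (model_pair md') => //; apply: (ow a).
    + by rewrite dw !inE eqxx.
    + by rewrite !inE eqxx.
    + by apply: contra we => rw; rewrite (model_eq md' rw re qw qe).
  - have dw := edge_p _ wf wg we pw; constructor 3; split=> //.
    apply: (model_pair md') => //; apply: (ow b).
    + by rewrite dw !inE eqxx.
    + by rewrite !inE eqxx orbT.
    + by apply: contra wf => rw; rewrite (model_eq md' rw rf pw pf).
have de := model_pair md xe ae xa; have df := model_pair md xf bf xb.
have dg := model_pair md xg cg xc.
have de' := model_pair md' re qe rq; have df' := model_pair md' rf pf rp.
have dg' := model_pair md' qg pg qp; have dw0' := model_pair md' rw0 ow0 ro.
(* The final defaults stand for [c] going to [o] and back: [Vall] and [Vall'] leave no fifth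
   vertex. *)
pose F z := if z == x then r else if z == a then q else if z == b then p else o.
pose F' z := if z == r then x else if z == q then a else if z == p then b else c.
have Fx : F x = r by rewrite /F eqxx.
have Fa : F a = q by rewrite /F eq_sym (negPf xa) eqxx.
have Fb : F b = p by rewrite /F eq_sym (negPf xb) eq_sym (negPf ab) eqxx.
have Fc : F c = o.
  by rewrite /F ![c == _]eq_sym (negPf xc) (negPf ac) (negPf bc).
have Fr : F' r = x by rewrite /F' eqxx.
have Fq : F' q = a by rewrite /F' eq_sym (negPf rq) eqxx.
have Fp : F' p = b by rewrite /F' eq_sym (negPf rp) eq_sym (negPf qp) eqxx.
have Fo : F' o = c.
  by rewrite /F' ![o == _]eq_sym (negPf ro) (negPf qo) (negPf po).
have Vall z : z \in [:: x; a; b; c].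
  have [w] := model_cover md z; case: (kinds w) => [|[-> _]|[-> _]]; rewrite !inE.
  - case/or4P=> /eqP->; rewrite ?de ?df ?dg ?dw0 !inE => /orP[]->;
    by rewrite ?orbT.
  - by case/orP=> ->; rewrite ?orbT.
  - by case/orP=> ->; rewrite ?orbT.
have Vall' z : z \in [:: r; q; p; o].
  have [w] := model_cover md' z; case: (kinds w) => [|[_ ->]|[_ ->]]; rewrite !inE.
  - case/or4P=> /eqP->; rewrite ?de' ?df' ?dg' ?dw0' !inE => /orP[]->;
    by rewrite ?orbT.
  - by case/orP=> ->; rewrite ?orbT.
  - by case/orP=> ->; rewrite ?orbT.
exists F, (tperm g w0); split.
- exists F' => z.
    have := Vall z; rewrite !inE => /or4P[]/eqP->;
    by rewrite ?Fx ?Fa ?Fb ?Fc ?Fr ?Fq ?Fp ?Fo.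
  have := Vall' z; rewrite !inE => /or4P[]/eqP->;
  by rewrite ?Fr ?Fq ?Fp ?Fo ?Fx ?Fa ?Fb ?Fc.
- by exists (tperm g w0) => z; rewrite tpermK.
- move=> w; have [->|ng] := eqVneq w g.
    by rewrite tpermL dw0' dg imsetU !imset_set1 Fx Fc.
  have [->|nw0] := eqVneq w w0.
    by rewrite tpermR dg' dw0 imsetU !imset_set1 Fa Fb.
  rewrite tpermD; [|by rewrite eq_sym..].
  case: (kinds w) => [|[-> ->]|[-> ->]]; last 2 first.
  + by rewrite imsetU !imset_set1 Fa Fc.
  + by rewrite imsetU !imset_set1 Fb Fc.
  rewrite !inE (negPf ng) (negPf nw0) !orbF => /orP[]/eqP->.
    by rewrite de de' imsetU !imset_set1 Fx Fa.
  by rewrite df df' imsetU !imset_set1 Fx Fb.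
Qed.

Lemma claw_triangle_iso e f g : connected_graph G -> 4 <= #|G| ->
  adj e f -> adj e g -> adj f g -> claw d e f g -> ~~ claw d' e f g ->
  model_iso d d'.
Proof.
move=> conn cardG ef eg fg /existsP[x /and3P[xe xf xg]] ncl.
have [nef neg nfg] := And3 (adj_neq ef) (adj_neq eg) (adj_neq fg).
have [a ae xa] := model_other md xe; have [b bf xb] := model_other md xf.
have [c cg xc] := model_other md xg.
have [r re rf] := (model_adj md' nef).1 ef.
have [q qe qg] := (model_adj md' neg).1 eg.
have [p pf pg] := (model_adj md' nfg).1 fg.
have mt : mixed_triple e f g x a b c p q r.
  split=> //; split=> //.
  - by apply: contraNneq nef => E; subst b; rewrite (model_eq md xe xf ae bf).
  - by apply: contraNneq neg => E; subst c; rewrite (model_eq md xe xg ae cg).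
  - by apply: contraNneq nfg => E; subst c; rewrite (model_eq md xf xg bf cg).
  - by apply: contraNneq ncl => E; subst q; apply/existsP; exists r; apply/and3P.
  - by apply: contraNneq ncl => E; subst p; apply/existsP; exists r; apply/and3P.
  - by apply: contraNneq ncl => E; subst p; apply/existsP; exists q; apply/and3P.
(* Order at least 4 enters here: the claw and the triangle themselves have the same line graph. The
   fourth edge touches the triangle at some corner, which the swaps move to [r]. *)
have [w] : exists w, w \notin [:: e; f; g].
  apply/existsP; rewrite -negb_forall; apply: contraL cardG => /forallP all_in.
  rewrite -ltnNge ltnS -[3]/(size [:: e; f; g]).
  apply: leq_trans (card_size _); apply/subset_leq_card/subsetP=> w _.
  exact: all_in.
rewrite !inE !negb_or => /and3P[we wf wg].
case: (mixed_total conn mt w) => [|rw|qw|pw].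
- by rewrite !inE (negPf we) (negPf wf) (negPf wg).
- exact: (mixed_iso conn mt we wf wg rw).
- exact: (mixed_iso conn (mixed_swap23 mt) we wg wf qw).
- exact: (mixed_iso conn (mixed_swap23 (mixed_swap12 mt)) wf wg we pw).
Qed.
End MixedTriple.

Theorem line_model_unique (G : sgraph) (V V' : finType)
    (d : G -> {set V}) (d' : G -> {set V'}) :
  line_model d -> line_model d' -> connected_graph G -> 4 <= #|G| ->
  model_iso d d'.
Proof.
move=> md md' conn cardG.
have [/existsP[e /existsP[f /existsP[g /and4P[ef eg fg ne]]]]|same] :=
  boolP [exists e : G, exists f : G, exists g : G,
    [&& adj e f, adj e g, adj f g & claw d e f g != claw d' e f g]].
  case cl: (claw d e f g) ne => ne.
    by apply: claw_triangle_iso ef eg fg cl _ => //; case: (claw _ _ _ _) ne.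
  apply/model_iso_sym/(claw_triangle_iso md' md conn cardG ef eg fg).
    by case: (claw d' _ _ _) ne.
  by rewrite cl.
apply: same_triples_iso => //; last by apply: leq_trans cardG.
move=> u v w uv uw vw; have [//|ne] := eqVneq (claw d u v w) (claw d' u v w).
case/negP: same; apply/existsP; exists u; apply/existsP; exists v.
apply/existsP; exists w.
exact/and4P.
Qed.

(** * Line graphs of multigraphs *)

Lemma line_model_of_mgraph (G : sgraph) (H : mgraph) (f : G -> medge H) :
  bijective f -> (forall u v, adj (f u : line_graph H) (f v) = adj u v) ->
  simple_mgraph H -> no_isolated H -> line_model (fun u => ends (f u)).
Proof.
move=> bf fadj [ll np] ni; split.
- move=> u; have := ends_card (f u); have := ll (f u); rewrite /is_loop.
  by case: #|_| => [|[|[|]]].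
- move=> u v e; apply: (bij_inj bf); have [//|/eqP ne] := eqVneq (f u) (f v).
  by case: (np (f u) (f v)).
- move=> x; have [e xe|none] := pickP [pred e : medge H | x \in ends e].
    by have [f' ff' f'f] := bf; exists (f' e); rewrite f'f.
  by case: (ni x) => e; rewrite -[_ \in _]/([pred e : medge H | x \in ends e] e) none.
- move=> u v uv; rewrite -fadj /= /line_adj (bij_eq bf) uv /=; split.
    by case/existsP=> x /andP[xu xv]; exists x.
  by case=> x xu xv; apply/existsP; exists x; rewrite xu.
Qed.

(** Parallel edges meet each other and the same further edges, so they are twins in the line
    graph. *)
Lemma twin_free_simple (G : sgraph) (H : mgraph) : loopless H ->
  sgraph_iso G (line_graph H) -> twin_free G -> simple_mgraph H.
Proof.
move=> ll [f [f' ff' f'f] fadj] tf; split=> // e1 e2 [ne eq12].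
have fe1 := f'f e1; have fe2 := f'f e2.
have ne12 : f' e1 != f' e2 by apply/eqP=> /(can_inj f'f).
apply: (tf (f' e1) (f' e2)); split; first exact/eqP.
apply/setP=> w; rewrite !inE -!fadj /= /line_adj fe1 fe2 eq12.
have adjn e : [exists x, (x \in ends e) && (x \in ends e)].
  have /andP[/card_gt0P[x xe] _] := ends_card e.
  by apply/existsP; exists x; rewrite xe.
have [->|w1] := eqVneq w (f' e1).
  by rewrite (negPf ne12) /= fe1 eq_sym (introN eqP ne) -eq12 adjn.
have [->|w2] := eqVneq w (f' e2).
  by rewrite /= fe2 (introN eqP ne) adjn.
rewrite /=; have -> : e1 != f w by apply: contraNneq w1 => ->; rewrite ff'.
by have -> : e2 != f w by apply: contraNneq w2 => ->; rewrite ff'.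
Qed.

Lemma model_iso_mgraph_iso (G : sgraph) (H H' : mgraph)
    (f : G -> medge H) (f' : G -> medge H') : bijective f -> bijective f' ->
  model_iso (fun u => ends (f u)) (fun u => ends (f' u)) -> mgraph_iso H H'.
Proof.
move=> [k fk kf] bf' [phi [s [bphi bs e]]].
exists phi, (f' \o s \o k); split=> //.
  by apply: bij_comp; [apply: bij_comp | exists f].
by move=> a; rewrite /= e kf.
Qed.

(** * Orthodox representations *)

Section OrthodoxRepresentation.
Variables (h t : nat) (G T : sgraph) (S : G -> {set T}).
Hypothesis rep : orthodox_rep h 2 t S.

Lemma rep_adj u v : u != v ->
  adj u v <-> exists x, [/\ x \in leaves T, x \in S u & x \in S v].
Proof. by case: rep => _ _ _ H /eqP/H[]. Qed.

Lemma rep_leaves_card u : 1 <= #|S u :&: leaves T| <= 2.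
Proof. by case: rep => _ /(_ u)[? ?] lv _; apply: card_subtree_leaves (lv u). Qed.

(* A trivial subtree contains one leaf only; its edge gets the additional
   vertex [inr u] as second end. *)
Definition rep_ends (u : G) : {set T + G} :=
  if #|S u :&: leaves T| == 2 then [set inl x | x in S u :&: leaves T]
  else inr u |: [set inl x | x in S u :&: leaves T].

Lemma inl_rep_ends x u : (inl x \in rep_ends u) = (x \in S u :&: leaves T).
Proof.
have inlI : injective (inl : T -> T + G) by move=> ? ? [].
by rewrite /rep_ends; case: ifP; rewrite ?inE (mem_imset _ _ inlI) ?inE.
Qed.

Lemma inr_rep_ends v u : inr v \in rep_ends u -> v = u.
Proof.
rewrite /rep_ends; case: ifP => _; first by case/imsetP.
by case/setU1P=> [[]//|/imsetP[]].
Qed.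

Lemma card_rep_ends u : #|rep_ends u| = 2.
Proof.
have inlI : injective (inl : T -> T + G) by move=> ? ? [].
have := rep_leaves_card u; rewrite /rep_ends.
case: eqP => [e _|]; first by rewrite card_imset.
rewrite cardsU1 card_imset //; case: #|_| => [|[|[|]]] // _ _.
by case: imsetP => // -[].
Qed.

Lemma rep_ends_card u : 1 <= #|rep_ends u| <= 2.
Proof. by rewrite card_rep_ends. Qed.

(** Two edges share a vertex [inl x] exactly when the subtrees share the leaf [x], and a vertex
    [inr w] lies on at most one edge, so it creates no adjacency. Isolated vertices, such as the
    inner vertices of [T], are harmless here. *)
Lemma rep_line_graph : exists H, loopless H /\ sgraph_iso G (line_graph H).
Proof.
exists (MGraph rep_ends_card); split.
  by move=> u; rewrite /is_loop /= card_rep_ends.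
exists id; first by exists id.
move=> u v; rewrite /= /line_adj /=.
have [->|uv] := eqVneq u v; first by rewrite adj_irrefl.
apply/existsP/idP => [[[x|w] /andP[]]|/(rep_adj uv)[x [xl xu xv]]].
- rewrite !inl_rep_ends !inE => /andP[xu xl] /andP[xv _].
  by apply/(rep_adj uv); exists x; rewrite inE.
- by move=> /inr_rep_ends-> /inr_rep_ends e; rewrite e eqxx in uv.
- by exists (inl x); rewrite !inl_rep_ends !in_setI xl xu xv.
Qed.

(** For [t] at least 2, a neighbour of [u] exists and its subtree shares at least [t] vertices with
    [S u]. *)
Lemma rep_nontrivial : connected_graph G -> 1 < #|G| ->
  (t = 1 -> no_trivial_subtree S) -> 1 <= t -> no_trivial_subtree S.
Proof.
move=> conn cardG nt t1 u; case: (ltngtP 1 t) t1 => // [t2 _|/esym/nt] //.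
have [v uv] := connected_neighbor u conn cardG.
have [_ _ _ /(_ u v)[|[/(_ uv) le _] _]] := rep; first exact/eqP/adj_neq.
apply: leq_trans t2 (leq_trans le _); apply: subset_leq_card.
exact: subsetIl.
Qed.

(** Unlike [rep_ends], this takes exactly the leaves of [T] as vertices, so that uniqueness of the
    model yields the bijection with the leaves. *)
Definition leaf_ends (u : G) : {set {x : T | x \in leaves T}} :=
  [set z | val z \in S u].

Lemma val_leaf_ends u : val @: leaf_ends u = S u :&: leaves T.
Proof.
apply/setP=> x; rewrite in_setI; apply/imsetP/andP=> [[z zu ->]|[xu xl]].
  by split; [rewrite inE in zu|exact: (valP z)].
by exists (Sub x xl); rewrite ?inE.
Qed.

Lemma leaf_ends_path u (x y : {x : T | x \in leaves T}) : x != y ->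
  leaf_ends u = [set x; y] <-> path_between (val x) (val y) (S u).
Proof.
move=> xy; have [_ /(_ u)[tr dg] lv _] := rep.
have vxy : val x != val y by [].
have pbP := path_between_leavesP tr dg (lv u) (valP x) (valP y) vxy.
split=> [e|/pbP].
  by apply/pbP; rewrite -val_leaf_ends e imsetU !imset_set1.
rewrite -val_leaf_ends -!imset_set1 -imsetU.
exact: (imset_inj val_inj).
Qed.

(** Adjacency depends only on the leaves contained in the subtrees, so two vertices with the same
    leaves would be twins; this gives injectivity. *)
Lemma leaf_line_model : no_trivial_subtree S -> twin_free G ->
  (forall x, x \in leaves T -> exists u, x \in S u) -> line_model leaf_ends.
Proof.
move=> nt tf cover.
have adjP u v : u != v ->
    adj u v <-> exists2 x, x \in leaf_ends u & x \in leaf_ends v.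
  move=> uv; split=> [/(rep_adj uv)[x [xl xu xv]]|[x]].
    by exists (Sub x xl); rewrite inE.
  rewrite !inE => xu xv; apply/(rep_adj uv); exists (val x); split=> //.
  exact: (valP x).
have card2 u : #|leaf_ends u| = 2.
  have [_ /(_ u)[tr dg] lv _] := rep.
  rewrite -(card_imset _ val_inj) val_leaf_ends.
  exact: (card_nontrivial_subtree_leaves tr dg (lv u)).
split=> //; last first.
  by case=> x xl; have [u xu] := cover x xl; exists u; rewrite inE.
move=> u v e; have [//|uv] := eqVneq u v; case: (tf u v).
split; first exact/eqP.
have adj_uv : adj u v.
  apply/(adjP _ _ uv); have /card_gt0P[x xu] : 0 < #|leaf_ends u|.
    by rewrite card2.
  by exists x; rewrite // -e.
apply/setP=> w; rewrite !inE.
have [->|wu] := eqVneq w u; first by rewrite adj_sym adj_uv orbT.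
have [->|wv] := eqVneq w v; first by rewrite adj_uv.
rewrite /=; apply/idP/idP; rewrite eq_sym in wu; rewrite eq_sym in wv.
  by move/(adjP _ _ wu); rewrite e => /(adjP _ _ wv).
by move/(adjP _ _ wv); rewrite -e => /(adjP _ _ wu).
Qed.

End OrthodoxRepresentation.

Theorem theorem1 (h t : nat) (G T : sgraph) (S : G -> {set T})
    (h_ge3 : 3 <= h) (t_ge1 : 1 <= t)
    (rep : orthodox_rep h 2 t S)
    (cover : forall x : T, x \in leaves T -> exists u : G, x \in S u) :
  [/\ exists H : mgraph, loopless H /\ sgraph_iso G (line_graph H),
      forall H : mgraph, loopless H -> sgraph_iso G (line_graph H) ->
        twin_free G -> simple_mgraph H
    & connected_graph G -> twin_free G -> 4 <= #|[set: G]| ->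
      forall H : mgraph, loopless H -> sgraph_iso G (line_graph H) ->
        no_isolated H ->
        (forall H' : mgraph, loopless H' -> sgraph_iso G (line_graph H') ->
           no_isolated H' -> mgraph_iso H H') /\
        ((t = 1 -> no_trivial_subtree S) ->
         exists phi : mvertex H -> {x : T | x \in leaves T},
           bijective phi /\
           forall x y : mvertex H, x <> y ->
             (madj x y <->
              exists u : G, path_between (val (phi x)) (val (phi y)) (S u)))].
Proof.
split; [exact: rep_line_graph rep | exact: twin_free_simple |].
move=> conn tf cardG H ll iso ni; rewrite cardsT in cardG.
have cardG1 : 1 < #|G| by apply: leq_trans cardG.
have sH := twin_free_simple ll iso tf; have [f bf fadj] := iso.
have mH := line_model_of_mgraph bf fadj sH ni.
split=> [H' ll' iso' ni'|nt1].
  have sH' := twin_free_simple ll' iso' tf; have [f' bf' fadj'] := iso'.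
  have mH' := line_model_of_mgraph bf' fadj' sH' ni'.
  apply: model_iso_mgraph_iso bf bf' _.
  exact: line_model_unique mH mH' conn cardG.
have nt := rep_nontrivial rep conn cardG1 nt1 t_ge1.
have mT := leaf_line_model rep nt tf cover.
(* Both [H] and the leaves of [T] are models of [G], so uniqueness supplies [phi], up to a
   permutation [s] of the vertices of [G]. *)
have [phi [s [bphi [s' ss' s's] e]]] := line_model_unique mH mT conn cardG.
exists phi; split=> // x y /eqP xy.
have pxy : phi x != phi y by rewrite (bij_eq bphi).
have [k fk kf] := bf; split.
  (* The edge [a] of [H] is the vertex [k a] of [G]; its ends are carried by [phi] to the leaves of
     the subtree of [s (k a)], not of [k a]. *)
  case=> a ea; exists (s (k a)); apply/(leaf_ends_path rep _ pxy).
  by rewrite e kf ea imsetU !imset_set1.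
case=> u /(leaf_ends_path rep _ pxy); rewrite -(s's u) e => eu.
exists (f (s' u)); apply: (imset_inj (bij_inj bphi)).
by rewrite eu imsetU !imset_set1.
Qed.
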